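(* $\mathrm{S}^{\neq}$ and $\mathrm{S}^{=}$ are closed under word quotient.
   Context: Let $\Gamma=\Sigma\cup\{¢,\$\}$, where ¢ and \$ are left and right end-markers. A PFA $\mathcal{P}=(S,\Sigma,\{\mathsf{A}_\sigma:\sigma\in\Gamma\},F)$ has states $S=\{s_1,\dots,s_n\}$ (start state $s_1$), real stochastic $n\times n$ transition matrices $\mathsf{A}_\sigma$, and accepting states $F$; its acceptance probability on $w\in\Sigma^*$ is $f_{\mathcal{P}}(w)=\sum_{s_i\in F}\mathsf{v}(i)$, where $\mathsf{v}=(1,0,\dots,0)\mathsf{A}_{¢}\mathsf{A}_{w_1}\cdots\mathsf{A}_{w_{|w|}}\mathsf{A}_{\$}$. $\mathrm{S}^{=}$ is the class of languages $\{w: f_{\mathcal{P}}(w)=\lambda\}$ and $\mathrm{S}^{\neq}$ the class of languages $\{w: f_{\mathcal{P}}(w)\neq\lambda\}$, for some PFA $\mathcal{P}$ and $\lambda\in[0,1]$. The word quotients of $L$ by a fixed word $w$ are $\{y\mid wy\in L\}$ and $\{z\mid zw\in L\}$. *)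

(* Defs.v *)
From mathcomp Require Import all_boot all_order all_algebra.
From mathcomp Require Import boolp classical_sets reals.

Set Implicit Arguments.
Unset Strict Implicit.
Unset Printing Implicit Defensive.

Import Order.TTheory GRing.Theory Num.Theory.

Local Open Scope classical_set_scope.
Local Open Scope ring_scope.

(* The tape alphabet: the input alphabet with the two end-markers adjoined. *)
Inductive tape_symbol (Sigma : Type) : Type :=
  | LeftEnd
  | Letter of Sigma
  | RightEnd.
Arguments LeftEnd {Sigma}.
Arguments RightEnd {Sigma}.

(* Row-stochastic, since state distributions are row vectors. *)
Definition stochastic (R : realType) (n : nat) (A : 'M[R]_n) : Prop :=
  (forall i j, 0 <= A i j) /\ (forall i, \sum_(j < n) A i j = 1).

(* The states are the elements of 'I_n.+1 with n = pfa_dim, so that there is at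
   least one; the start state s_1 is ord0. *)
Record pfa (R : realType) (Sigma : finType) : Type := PFA {
  pfa_dim : nat;
  pfa_trans : tape_symbol Sigma -> 'M[R]_(pfa_dim.+1);
  pfa_transP : forall s, stochastic (pfa_trans s);
  pfa_final : {set 'I_(pfa_dim.+1)}
}.

Definition pfa_step (R : realType) (Sigma : finType) (P : pfa R Sigma)
    (v : 'rV[R]_((pfa_dim P).+1)) (s : tape_symbol Sigma) :
    'rV[R]_((pfa_dim P).+1) :=
  v *m pfa_trans P s.

Definition tape (Sigma : Type) (w : seq Sigma) : seq (tape_symbol Sigma) :=
  LeftEnd :: rcons (map (@Letter Sigma) w) RightEnd.

Definition pfa_run (R : realType) (Sigma : finType) (P : pfa R Sigma)
    (w : seq Sigma) : 'rV[R]_((pfa_dim P).+1) :=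
  foldl (@pfa_step R Sigma P) (delta_mx 0 ord0) (tape w).

Definition acc_prob (R : realType) (Sigma : finType) (P : pfa R Sigma)
    (w : seq Sigma) : R :=
  \sum_(i in pfa_final P) pfa_run P w 0 i.

Definition language (Sigma : finType) : Type := set (seq Sigma).

Definition S_eq (R : realType) (Sigma : finType) (L : language Sigma) : Prop :=
  exists (P : pfa R Sigma) (lambda : R),
    0 <= lambda <= 1 /\ L = [set w | acc_prob P w = lambda].

Definition S_neq (R : realType) (Sigma : finType) (L : language Sigma) : Prop :=
  exists (P : pfa R Sigma) (lambda : R),
    0 <= lambda <= 1 /\ L = [set w | acc_prob P w <> lambda].

Definition left_quotient (Sigma : finType) (w : seq Sigma) (L : language Sigma) :
    language Sigma :=
  [set y | L (w ++ y)].

Definition right_quotient (Sigma : finType) (w : seq Sigma) (L : language Sigma) :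
    language Sigma :=
  [set z | L (z ++ w)].

Definition closed_under_word_quotient
    (C : forall Sigma : finType, language Sigma -> Prop) : Prop :=
  forall (Sigma : finType) (L : language Sigma) (w : seq Sigma),
    C Sigma L ->
    C Sigma (left_quotient w L) /\ C Sigma (right_quotient w L).

(* Main.v *)
Require Import Defs.
From mathcomp Require Import all_boot all_order all_algebra.
From mathcomp Require Import boolp classical_sets reals.

(* The transition matrix of a fixed prefix [u] can be absorbed into that of the
   left end-marker, and that of a fixed suffix [v] into that of the right
   end-marker; stochastic matrices being closed under product, the result is a
   PFA accepting [y] with the probability that the original one accepts
   [u ++ y ++ v]. *)

Set Implicit Arguments.
Unset Strict Implicit.
Unset Printing Implicit Defensive.

Import Order.TTheory GRing.Theory Num.Theory.

Local Open Scope ring_scope.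

Lemma stochastic1 (R : realType) (n : nat) : stochastic (1%:M : 'M[R]_n).
Proof.
split=> [i j|i]; first by rewrite mxE ler0n.
rewrite (bigD1 i) //= big1 => [|j /negPf neq_ji]; first by rewrite mxE eqxx addr0.
by rewrite mxE eq_sym neq_ji.
Qed.

Lemma stochastic_mul (R : realType) (n : nat) (A B : 'M[R]_n) :
  stochastic A -> stochastic B -> stochastic (A *m B).
Proof.
move=> [A_ge0 A_sum1] [B_ge0 B_sum1]; split=> [i j|i].
  by rewrite mxE sumr_ge0 // => k _; rewrite mulr_ge0.
under eq_bigr do rewrite mxE.
(* The right-hand [1] is expanded into row [i] of [A], so that the sums over [k] match termwise once
   row [k] of [B] is summed. *)
rewrite exchange_big /= -[RHS](A_sum1 i); apply: eq_bigr => k _.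
by rewrite -mulr_sumr B_sum1 mulr1.
Qed.

Section WordContext.

Variables (R : realType) (Sigma : finType) (P : pfa R Sigma).

(** Distributions are row vectors, so the first letter's matrix is the leftmost factor. *)
Definition word_mx (w : seq Sigma) : 'M[R]_((pfa_dim P).+1) :=
  foldr (fun a M => pfa_trans P (Letter a) *m M) 1%:M w.

Lemma word_mx_stochastic w : stochastic (word_mx w).
Proof.
elim: w => [|a w IHw] /=; first exact: stochastic1.
by apply: stochastic_mul => //; apply: pfa_transP.
Qed.

Lemma word_mx_cat u v : word_mx (u ++ v) = word_mx u *m word_mx v.
Proof. by elim: u => [|a u IHu] /=; rewrite ?mul1mx // IHu mulmxA. Qed.

Lemma foldl_step_word v w :
  foldl (@pfa_step R Sigma P) v [seq Letter a | a <- w] = v *m word_mx w.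
Proof.
by elim: w v => [|a w IHw] v /=; rewrite ?mulmx1 // IHw /pfa_step mulmxA.
Qed.

Lemma pfa_runE w :
  pfa_run P w = delta_mx 0 ord0 *m pfa_trans P LeftEnd *m word_mx w
                  *m pfa_trans P RightEnd.
Proof. by rewrite /pfa_run /= foldl_rcons foldl_step_word. Qed.

Variables u v : seq Sigma.

Definition context_trans (s : tape_symbol Sigma) : 'M[R]_((pfa_dim P).+1) :=
  match s with
  | LeftEnd => pfa_trans P LeftEnd *m word_mx u
  | Letter a => pfa_trans P (Letter a)
  | RightEnd => word_mx v *m pfa_trans P RightEnd
  end.

Lemma context_trans_stochastic s : stochastic (context_trans s).
Proof.
case: s => [|a|] /=; last 2 first.
- exact: pfa_transP.
- by apply: stochastic_mul; [exact: word_mx_stochastic | exact: pfa_transP].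
- by apply: stochastic_mul; [exact: pfa_transP | exact: word_mx_stochastic].
Qed.

Definition context_pfa : pfa R Sigma :=
  @PFA R Sigma (pfa_dim P) context_trans context_trans_stochastic (pfa_final P).

End WordContext.

Lemma acc_prob_context (R : realType) (Sigma : finType) (P : pfa R Sigma)
    (u v y : seq Sigma) :
  acc_prob (context_pfa P u v) y = acc_prob P (u ++ y ++ v).
Proof.
rewrite /acc_prob; apply: eq_bigr => i _; rewrite !pfa_runE /= !word_mx_cat.
(* Letters keep their matrices, so [word_mx (context_pfa P u v) y] is convertible to [word_mx P y];
   only the bracketing differs. *)
by rewrite !mulmxA.
Qed.

Theorem theorem5p9 (R : realType) :
  closed_under_word_quotient (@S_neq R) /\
  closed_under_word_quotient (@S_eq R).
Proof.
split=> Sigma L w [P [lambda [lambda01 ->]]]; split;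
  (* A left quotient fixes only a prefix, a right quotient only a suffix. The acceptance
     probabilities agree exactly, so the same [lambda] serves for both [=] and [<>]. *)
  [exists (context_pfa P w [::]) | exists (context_pfa P [::] w)
  |exists (context_pfa P w [::]) | exists (context_pfa P [::] w)];
  exists lambda; split=> //; apply/funext => y;
  by rewrite /left_quotient /right_quotient /= acc_prob_context ?cats0.
Qed.
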